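(* Let $K$ be a field with $\operatorname{char}K\neq 2,3$ and let $F=E\otimes E_{i_1}\otimes\cdots\otimes E_{i_s}$ for some $s\geq 0$ and any choice of integers $i_1,\dots,i_s\geq 2$. If $F$ does not satisfy the identity $[x_1,\dots,x_{2k+1}]=0$ for some positive integer $k$, then $F$ does not satisfy the identity $[x_1,\dots,x_{2k+2}]=0$ either.
   Context: $E$ denotes the (unital) Grassmann (exterior) algebra over a $K$-vector space of countably infinite dimension, and $E_r$ ($r\ge2$) the Grassmann algebra over an $r$-dimensional $K$-vector space. $\otimes=\otimes_K$ is the ordinary (ungraded) tensor product of algebras. Long commutators are left-normed: $[u_1,u_2]=u_1u_2-u_2u_1$ and $[u_1,\dots,u_{m+1}]=[[u_1,\dots,u_m],u_{m+1}]$ for $m\ge 2$. An algebra satisfies an identity if the identity holds for all substitutions of algebra elements for the variables. *)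

(* Defs.v *)
From HB Require Import structures.
From mathcomp Require Import all_boot all_order all_algebra.
From mathcomp Require Import generic_quotient ring_quotient.
From mathcomp Require Import finmap monalg boolp classical_sets.

Set Implicit Arguments.
Unset Strict Implicit.
Unset Printing Implicit Defensive.

Import Order.TTheory GRing.Theory.

Local Open Scope ring_scope.
Local Open Scope quotient_scope.

(* The free K-module on B is {malg K[B]}, with basis << b >> for b : B.       *)

HB.lock Definition lext (K : fieldType) (B : choiceType) (M : lmodType K)
    (f : B -> M) (x : {malg K[B]}) : M :=
  \sum_(b <- msupp x) x@_b *: f b.

Section LinearExtension.
Variables (K : fieldType) (B : choiceType).

Lemma lextE (M : lmodType K) (f : B -> M) x :
  lext f x = \sum_(b <- msupp x) x@_b *: f b.
Proof. by rewrite lext.unlock. Qed.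

Lemma lextEw (M : lmodType K) (f : B -> M) (d : {fset B}) x :
  (msupp x `<=` d)%fset -> lext f x = \sum_(b <- d) x@_b *: f b.
Proof.
move=> le; rewrite lextE [LHS](big_fset_incl _ le) => //= b bd /mcoeff_outdom ->.
by rewrite scale0r.
Qed.

Lemma lext_is_linear (M : lmodType K) (f : B -> M) : linear (lext f).
Proof.
move=> c x y; pose d := (msupp x `|` msupp y `|` msupp (c *: x + y))%fset.
rewrite !(@lextEw _ f d) /d ?fsubsetUr //.
- rewrite scaler_sumr -big_split; apply: eq_bigr => b _ /=.
  by rewrite mcoeffD mcoeffZ scalerDl scalerA.
- by rewrite -fsetUA fsetUCA fsubsetUl.
- by rewrite -fsetUA fsubsetUl.
Qed.

HB.instance Definition _ (M : lmodType K) (f : B -> M) :=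
  GRing.isLinear.Build K {malg K[B]} M _ (lext f) (lext_is_linear f).

Lemma lextD (M : lmodType K) (f : B -> M) : {morph lext f : x y / x + y}.
Proof. exact: linearD. Qed.

Lemma lextB (M : lmodType K) (f : B -> M) : {morph lext f : x y / x - y}.
Proof. exact: linearB. Qed.

Lemma lextZ (M : lmodType K) (f : B -> M) c :
  {morph lext f : x / c *: x >-> c *: x}.
Proof. exact: linearZ. Qed.

Lemma lextU (M : lmodType K) (f : B -> M) b : lext f << b >> = f b.
Proof. by rewrite (lextEw _ msuppU_le) big_seq_fset1 mcoeffUU scale1r. Qed.

Lemma malg_ind (P : {malg K[B]} -> Prop) :
  P 0 -> (forall c x y, P x -> P y -> P (c *: x + y)) ->
  (forall b, P << b >>) -> forall x, P x.
Proof.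
move=> P0 PD PU x; rewrite [x]monalgE.
elim: (enum_fset (msupp x)) => [|b s IHs]; first by rewrite big_nil.
rewrite big_cons; suff -> : << x@_b *g b >> = x@_b *: << b >> :> {malg K[B]}.
  exact: PD.
by apply/malgP => b'; rewrite mcoeffZ !mcoeffU mulrnAr mulr1.
Qed.

(* The bilinear product on {malg K[B]} with << b >> * << b' >> = c b b'.      *)
Definition bext (c : B -> B -> {malg K[B]}) (x y : {malg K[B]}) : {malg K[B]} :=
  lext (fun b => lext (c b) y) x.

Variable c : B -> B -> {malg K[B]}.

Lemma bextUU b b' : bext c << b >> << b' >> = c b b'.
Proof. by rewrite /bext !lextU. Qed.

Lemma bextPl a x y z : bext c (a *: x + y) z = a *: bext c x z + bext c y z.
Proof. exact: linearP. Qed.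

Lemma bextPr a x y z : bext c z (a *: x + y) = a *: bext c z x + bext c z y.
Proof.
rewrite /bext !lextE scaler_sumr -big_split; apply: eq_bigr => b _ /=.
by rewrite linearP scalerDr !scalerA mulrC.
Qed.

Lemma bext0l z : bext c 0 z = 0.
Proof. exact: linear0. Qed.

Lemma bext0r z : bext c z 0 = 0.
Proof. by have := bextPr (-1) 0 0 z; rewrite scaler0 addr0 scaleN1r addNr. Qed.

Lemma bextA : (forall p q r, bext c (c p q) << r >> = bext c << p >> (c q r)) ->
  associative (bext c).
Proof.
move=> cA x y z.
elim/malg_ind: x => [|a x x' IHx IHx'|p]; first by rewrite !bext0l.
  by rewrite !bextPl IHx IHx'.
elim/malg_ind: y => [|a y y' IHy IHy'|q].
- by rewrite bext0l !bext0r bext0l.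
- by rewrite !(bextPl, bextPr) IHy IHy'.
elim/malg_ind: z => [|a z z' IHz IHz'|r]; first by rewrite !bext0r.
  by rewrite !bextPr IHz IHz'.
by rewrite !bextUU cA.
Qed.

Lemma bextDl : left_distributive (bext c) +%R.
Proof. by move=> x y z; have := bextPl 1 x y z; rewrite !scale1r. Qed.

Lemma bextDr : right_distributive (bext c) +%R.
Proof. by move=> x y z; have := bextPr 1 y z x; rewrite !scale1r. Qed.

Lemma bextZl a x y : a *: bext c x y = bext c (a *: x) y.
Proof. by have := bextPl a x 0 y; rewrite bext0l !addr0. Qed.

Lemma bextZr a x y : a *: bext c x y = bext c x (a *: y).
Proof. by have := bextPr a y 0 x; rewrite bext0r !addr0. Qed.

Lemma bext1l e : (forall b, c e b = << b >>) -> left_id << e >> (bext c).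
Proof.
move=> ce; elim/malg_ind => [|a x y IHx IHy|b]; first exact: bext0r.
  by rewrite bextPr IHx IHy.
by rewrite bextUU.
Qed.

Lemma bext1r e : (forall b, c b e = << b >>) -> right_id << e >> (bext c).
Proof.
move=> ce; elim/malg_ind => [|a x y IHx IHy|b]; first exact: bext0l.
  by rewrite bextPl IHx IHy.
by rewrite bextUU.
Qed.

End LinearExtension.

(* The Grassmann algebra of the K-vector space with basis (e_i), i : I.       *)
(* Its basis element << S >>, for S = {i_1 < ... < i_m} a finite subset of I, *)
(* is e_{i_1} ... e_{i_m}.                                                    *)

Definition grassmann (K : fieldType) d (I : orderType d) : Type :=
  {malg K[{fset I}]}.

Section Grassmann.
Variables (K : fieldType) (d : Order.disp_t) (I : orderType d).
Implicit Types S T U : {fset I}.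
Local Notation E := (grassmann K I).

HB.instance Definition _ := GRing.Lmodule.on E.

(* The number of transpositions needed to sort e_S e_T. *)
Definition inversions S T : nat :=
  (\sum_(i <- enum_fset S) \sum_(j <- enum_fset T) (j < i)%O)%N.

Definition grassmann_basis_mul S T : {malg K[{fset I}]} :=
  if [disjoint S & T]%fset then (-1) ^+ inversions S T *: << (S `|` T)%fset >>
  else 0.

Definition grassmann_mul : E -> E -> E := bext grassmann_basis_mul.
Definition grassmann_one : E := << fset0 >>.
Definition egen (i : I) : E := << [fset i]%fset >>.

Lemma inversionsUl S T U : [disjoint S & T]%fset ->
  inversions (S `|` T)%fset U = (inversions S U + inversions T U)%N.
Proof.
move=> dST; rewrite /inversions -big_cat; apply: perm_big.
apply: uniq_perm; rewrite ?fset_uniq // ?cat_uniq ?fset_uniq ?andbT /=.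
  apply/hasPn => i iT; apply/negP => iS.
  by move/fdisjointP: dST => /(_ i iS); rewrite iT.
by move=> i; rewrite in_fsetU mem_cat.
Qed.

Lemma inversionsUr S T U : [disjoint S & T]%fset ->
  inversions U (S `|` T)%fset = (inversions U S + inversions U T)%N.
Proof.
move=> dST; rewrite /inversions -big_split; apply: eq_bigr => j _ /=.
rewrite -big_cat; apply: perm_big.
apply: uniq_perm; rewrite ?fset_uniq // ?cat_uniq ?fset_uniq ?andbT /=.
  apply/hasPn => i iT; apply/negP => iS.
  by move/fdisjointP: dST => /(_ i iS); rewrite iT.
by move=> i; rewrite in_fsetU mem_cat.
Qed.

Lemma grassmann_mulA : associative grassmann_mul.
Proof.
apply: bextA => S T U; rewrite /grassmann_basis_mul.
case dST: [disjoint S & T]%fset; last first.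
  rewrite bext0l; case dTU: [disjoint T & U]%fset; last by rewrite bext0r.
  rewrite -bextZr bextUU /grassmann_basis_mul fdisjointXU dST.
  by rewrite scaler0.
rewrite -bextZl bextUU /grassmann_basis_mul fdisjointUX.
case dTU: [disjoint T & U]%fset; last by rewrite bext0r andbF scaler0.
rewrite -bextZr bextUU /grassmann_basis_mul fdisjointXU dST andbT /=.
case dSU: [disjoint S & U]%fset; last by rewrite !scaler0.
rewrite (inversionsUl _ dST) (inversionsUr _ dTU) fsetUA.
rewrite [LHS]scalerA [RHS]scalerA -[in LHS]exprD -[in RHS]exprD.
by rewrite addnA [in RHS]addnC.
Qed.

Lemma grassmann_mul1l : left_id grassmann_one grassmann_mul.
Proof.
apply: bext1l => S; rewrite /grassmann_basis_mul fdisjoint0X fset0U.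
by rewrite /inversions big_nil scale1r.
Qed.

Lemma grassmann_mul1r : right_id grassmann_one grassmann_mul.
Proof.
apply: bext1r => S; rewrite /grassmann_basis_mul fdisjointX0 fsetU0.
by rewrite /inversions big1 ?scale1r // => i _; rewrite big_nil.
Qed.

Lemma grassmann_oner_neq0 : grassmann_one != 0.
Proof.
apply/eqP => /(congr1 (mcoeff fset0)); rewrite mcoeffUU mcoeff0.
by apply/eqP; rewrite oner_neq0.
Qed.

HB.instance Definition _ := GRing.Zmodule_isNzRing.Build E
  grassmann_mulA grassmann_mul1l grassmann_mul1r
  (@bextDl _ _ _) (@bextDr _ _ _) grassmann_oner_neq0.

HB.instance Definition _ := GRing.Lmodule_isLalgebra.Build K E (@bextZl _ _ _).
HB.instance Definition _ := GRing.Lalgebra_isAlgebra.Build K E (@bextZr _ _ _).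

Lemma egen_sqr i : egen i * egen i = 0.
Proof.
rewrite /egen [LHS]bextUU /grassmann_basis_mul.
by rewrite fdisjointX1 in_fset1 eqxx.
Qed.

Lemma egenC i j : egen i * egen j = - (egen j * egen i).
Proof.
have [->|nij] := eqVneq i j; first by rewrite egen_sqr oppr0.
rewrite /egen [LHS]bextUU [X in - X]bextUU /grassmann_basis_mul.
rewrite !fdisjointX1 !in_fset1 eq_sym nij fsetUC -scaleNr.
rewrite /inversions !big_seq_fset1.
suff -> : (-1) ^+ (j < i)%O = - (-1) ^+ (i < j)%O :> K by [].
by case: ltgtP nij => // _ _; rewrite expr0 expr1 ?opprK.
Qed.

End Grassmann.

(* The tensor product over K of two K-algebras, as the quotient of the free   *)
(* K-module on A * B by the submodule generated by the bilinearity relations. *)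

Section TensorProduct.
Variables (K : fieldType) (A B : algType K).
Local Notation free := {malg K[(A * B)%type]}.

Inductive tensor_rel : free -> Prop :=
  | tensor_rel0 : tensor_rel 0
  | tensor_relP c x y : tensor_rel x -> tensor_rel y -> tensor_rel (c *: x + y)
  | tensor_relDl a a' b :
      tensor_rel (<< (a + a', b) >> - (<< (a, b) >> + << (a', b) >>))
  | tensor_relDr a b b' :
      tensor_rel (<< (a, b + b') >> - (<< (a, b) >> + << (a, b') >>))
  | tensor_relZl c a b : tensor_rel (<< (c *: a, b) >> - c *: << (a, b) >>)
  | tensor_relZr c a b : tensor_rel (<< (a, c *: b) >> - c *: << (a, b) >>).

Definition tensor_null : {pred free} := fun x => `[< tensor_rel x >].

Lemma tensor_nullP x : reflect (tensor_rel x) (x \in tensor_null).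
Proof. exact: asboolP. Qed.

Lemma tensor_relB x y : tensor_rel x -> tensor_rel y -> tensor_rel (x - y).
Proof. by move=> rx ry; rewrite addrC -scaleN1r; apply: tensor_relP. Qed.

Lemma tensor_relZ c x : tensor_rel x -> tensor_rel (c *: x).
Proof. by move=> rx; rewrite -[_ *: _]addr0; apply: tensor_relP => //; exact: tensor_rel0. Qed.

Lemma tensor_null_zmod : zmod_closed tensor_null.
Proof.
split; first by apply/tensor_nullP; exact: tensor_rel0.
by move=> x y /tensor_nullP rx /tensor_nullP ry; apply/tensor_nullP/tensor_relB.
Qed.

HB.instance Definition _ :=
  GRing.isZmodClosed.Build free tensor_null tensor_null_zmod.

Definition tensor : Type := Quotient.quot tensor_null.

HB.instance Definition _ := GRing.Zmodule.on tensor.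

Definition tensor_pi (x : free) : tensor := \pi_(Quotient.quot tensor_null) x.
Definition tensor_repr (t : tensor) : free :=
  repr (t : Quotient.quot tensor_null).
Definition tens (a : A) (b : B) : tensor := tensor_pi << (a, b) >>.

Lemma tensor_reprK t : tensor_pi (tensor_repr t) = t.
Proof. exact: reprK. Qed.

Lemma tensor_piP x y : tensor_pi x = tensor_pi y <-> tensor_rel (x - y).
Proof.
split=> [/eqP|/tensor_nullP]; rewrite /tensor_pi.
  by rewrite -Quotient.idealrBE => /tensor_nullP.
by rewrite Quotient.idealrBE => /eqP.
Qed.

Lemma tensor_repr_pi x : tensor_rel (tensor_repr (tensor_pi x) - x).
Proof. by apply/tensor_piP; rewrite tensor_reprK. Qed.

Lemma tensor_piD : {morph tensor_pi : x y / x + y}.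
Proof. exact: Quotient.pi_add. Qed.

Lemma tensor_ind (P : tensor -> Prop) :
  (forall x, P (tensor_pi x)) -> forall t, P t.
Proof. by move=> Ppi t; rewrite -[t]tensor_reprK. Qed.

Definition tensor_scale (c : K) (t : tensor) : tensor :=
  tensor_pi (c *: tensor_repr t).

Lemma tensor_scale_pi c x : tensor_scale c (tensor_pi x) = tensor_pi (c *: x).
Proof.
by apply/tensor_piP; rewrite -scalerBr; apply/tensor_relZ/tensor_repr_pi.
Qed.

Definition tensor_free_mul : free -> free -> free :=
  bext (fun p q => << (p.1 * q.1, p.2 * q.2) >>).

Definition tensor_mul (t u : tensor) : tensor :=
  tensor_pi (tensor_free_mul (tensor_repr t) (tensor_repr u)).

Definition tensor_one : tensor := tens 1 1.

Lemma tensor_free_mulBl x y z :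
  tensor_free_mul (x - y) z = tensor_free_mul x z - tensor_free_mul y z.
Proof. by rewrite addrC -scaleN1r /tensor_free_mul bextPl scaleN1r addrC. Qed.

Lemma tensor_free_mulBr x y z :
  tensor_free_mul z (x - y) = tensor_free_mul z x - tensor_free_mul z y.
Proof. by rewrite addrC -scaleN1r /tensor_free_mul bextPr scaleN1r addrC. Qed.

Lemma tensor_rel_mull x y : tensor_rel x -> tensor_rel (tensor_free_mul x y).
Proof.
move=> rx; elim/malg_ind: y => [|c y y' IHy IHy'|[a0 b0]].
- by rewrite /tensor_free_mul bext0r; exact: tensor_rel0.
- by rewrite /tensor_free_mul bextPr; exact: (tensor_relP c IHy IHy').
elim: rx => [|c {}x y _ IHx _ IHy|a a' b|a b b'|c a b|c a b].
- by rewrite /tensor_free_mul bext0l; exact: tensor_rel0.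
- by rewrite /tensor_free_mul bextPl; exact: (tensor_relP c IHx IHy).
- rewrite tensor_free_mulBl /tensor_free_mul bextDl !bextUU /= mulrDl.
  exact: tensor_relDl.
- rewrite tensor_free_mulBl /tensor_free_mul bextDl !bextUU /= mulrDl.
  exact: tensor_relDr.
- rewrite tensor_free_mulBl /tensor_free_mul -bextZl !bextUU /= -scalerAl.
  exact: tensor_relZl.
- rewrite tensor_free_mulBl /tensor_free_mul -bextZl !bextUU /= -scalerAl.
  exact: tensor_relZr.
Qed.

Lemma tensor_rel_mulr x y : tensor_rel y -> tensor_rel (tensor_free_mul x y).
Proof.
move=> ry; elim/malg_ind: x => [|c x x' IHx IHx'|[a0 b0]].
- by rewrite /tensor_free_mul bext0l; exact: tensor_rel0.
- by rewrite /tensor_free_mul bextPl; exact: (tensor_relP c IHx IHx').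
elim: ry => [|c x {}y _ IHx _ IHy|a a' b|a b b'|c a b|c a b].
- by rewrite /tensor_free_mul bext0r; exact: tensor_rel0.
- by rewrite /tensor_free_mul bextPr; exact: (tensor_relP c IHx IHy).
- rewrite tensor_free_mulBr /tensor_free_mul bextDr !bextUU /= mulrDr.
  exact: tensor_relDl.
- rewrite tensor_free_mulBr /tensor_free_mul bextDr !bextUU /= mulrDr.
  exact: tensor_relDr.
- rewrite tensor_free_mulBr /tensor_free_mul -bextZr !bextUU /= -scalerAr.
  exact: tensor_relZl.
- rewrite tensor_free_mulBr /tensor_free_mul -bextZr !bextUU /= -scalerAr.
  exact: tensor_relZr.
Qed.

Lemma tensor_mul_pi x y :
  tensor_mul (tensor_pi x) (tensor_pi y) = tensor_pi (tensor_free_mul x y).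
Proof.
apply/tensor_piP; set x' := tensor_repr _; set y' := tensor_repr _.
rewrite -[X in X - _](subrK (tensor_free_mul x y')) -addrA.
rewrite -tensor_free_mulBl -tensor_free_mulBr -[X in tensor_rel (X + _)]scale1r.
apply: tensor_relP; first exact/tensor_rel_mull/tensor_repr_pi.
exact/tensor_rel_mulr/tensor_repr_pi.
Qed.

Lemma tensor_scaleA c c' t :
  tensor_scale c (tensor_scale c' t) = tensor_scale (c * c') t.
Proof. by elim/tensor_ind: t => x; rewrite !tensor_scale_pi scalerA. Qed.

Lemma tensor_scale1 : left_id 1 tensor_scale.
Proof. by elim/tensor_ind => x; rewrite tensor_scale_pi scale1r. Qed.

Lemma tensor_scaleDr : right_distributive tensor_scale +%R.
Proof.
move=> c; elim/tensor_ind => x; elim/tensor_ind => y.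
by rewrite -tensor_piD !tensor_scale_pi -tensor_piD scalerDr.
Qed.

Lemma tensor_scaleDl t : {morph tensor_scale^~ t : c c' / c + c'}.
Proof.
move=> c c'; elim/tensor_ind: t => x.
by rewrite !tensor_scale_pi -tensor_piD scalerDl.
Qed.

HB.instance Definition _ := GRing.Zmodule_isLmodule.Build K tensor
  tensor_scaleA tensor_scale1 tensor_scaleDr tensor_scaleDl.

Lemma tensor_mulA : associative tensor_mul.
Proof.
elim/tensor_ind => x; elim/tensor_ind => y; elim/tensor_ind => z.
rewrite 4!tensor_mul_pi.
apply: (congr1 tensor_pi).
apply: bextA => p q r.
by rewrite !bextUU /= !mulrA.
Qed.

Lemma tensor_mul1l : left_id tensor_one tensor_mul.
Proof.
elim/tensor_ind => x; rewrite tensor_mul_pi; apply: (congr1 tensor_pi).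
by apply: bext1l => -[a b]; rewrite /= !mul1r.
Qed.

Lemma tensor_mul1r : right_id tensor_one tensor_mul.
Proof.
elim/tensor_ind => x; rewrite tensor_mul_pi; apply: (congr1 tensor_pi).
by apply: bext1r => -[a b]; rewrite /= !mulr1.
Qed.

Lemma tensor_mulDl : left_distributive tensor_mul +%R.
Proof.
elim/tensor_ind => x; elim/tensor_ind => y; elim/tensor_ind => z.
by rewrite -tensor_piD !tensor_mul_pi -tensor_piD /tensor_free_mul bextDl.
Qed.

Lemma tensor_mulDr : right_distributive tensor_mul +%R.
Proof.
elim/tensor_ind => x; elim/tensor_ind => y; elim/tensor_ind => z.
by rewrite -tensor_piD !tensor_mul_pi -tensor_piD /tensor_free_mul bextDr.
Qed.

(* Bilinear maps factor through the tensor product. *)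
Section Universal.
Variables (M : lmodType K) (f : A -> B -> M).
Hypothesis fDl : forall a a' b, f (a + a') b = f a b + f a' b.
Hypothesis fDr : forall a b b', f a (b + b') = f a b + f a b'.
Hypothesis fZl : forall c a b, f (c *: a) b = c *: f a b.
Hypothesis fZr : forall c a b, f a (c *: b) = c *: f a b.

Let ff (p : A * B) := f p.1 p.2.

Definition tensor_lift (t : tensor) : M := lext ff (tensor_repr t).

Lemma lext_tensor_rel x : tensor_rel x -> lext ff x = 0.
Proof.
elim=> [|c {}x y _ IHx _ IHy|a a' b|a b b'|c a b|c a b].
- exact: linear0.
- by rewrite linearP /= IHx IHy scaler0 addr0.
- by rewrite lextB lextD 3!lextU /ff fDl subrr.
- by rewrite lextB lextD 3!lextU /ff fDr subrr.
- by rewrite lextB lextZ 2!lextU /ff fZl subrr.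
- by rewrite lextB lextZ 2!lextU /ff fZr subrr.
Qed.

Lemma tensor_lift_pi x : tensor_lift (tensor_pi x) = lext ff x.
Proof.
apply/eqP; rewrite -subr_eq0 -lextB.
by apply/eqP/lext_tensor_rel/tensor_repr_pi.
Qed.

Lemma tensor_lift_is_linear : linear tensor_lift.
Proof.
move=> c; elim/tensor_ind => x; elim/tensor_ind => y.
rewrite [c *: tensor_pi x]tensor_scale_pi -tensor_piD !tensor_lift_pi.
exact: linearP.
Qed.

Lemma tensor_lift_tens a b : tensor_lift (tens a b) = f a b.
Proof. by rewrite tensor_lift_pi lextU. Qed.

End Universal.

End TensorProduct.

(* Used only for 1 != 0 in the tensor product, which algType requires.         *)
Lemma unit_functional (K : fieldType) (A : algType K) :
  exists2 f : A -> K^o, linear f & f 1 = 1.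
Proof.
pose P (W : set A) := (forall c x y, W x -> W y -> W (c *: x + y)) /\ ~ W 1.
have [F FP Ftot|W [[Wlin W1] Wmax]] := @Zorn_bigcup A P.
  split=> [c x y [X FX Xx] [Y FY Yy]|[X FX X1]]; last by case: (FP _ FX).
  by have [XY|YX] := Ftot _ _ FX FY; [exists Y|exists X] => //;
    apply: (FP _ _).1 => //; [exact: XY|exact: YX].
have W0 : W 0.
  apply: contrapT => W0.
  refine (Wmax [set 0]%classic _ _).
    split=> [x Wx|sub]; last exact/W0/sub.
    by case: W0; have := Wlin (-1) _ _ Wx Wx; rewrite scaleN1r addNr.
  split=> [c x y -> ->|/= /eqP]; first by rewrite /= scaler0 addr0.
  by rewrite oner_eq0.
have WZ c x : W x -> W (c *: x).
  by move=> Wx; rewrite -[_ *: _]addr0; apply: Wlin.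
have ex a : exists c : K, W (a - c *: 1).
  have [Wa|nWa] := pselect (W a); first by exists 0; rewrite scale0r subr0.
  pose W' : set A := fun x => exists c : K, W (x - c *: a).
  have W'1 : W' 1.
    apply: contrapT => nW'1; refine (Wmax W' _ _).
      split=> [x Wx|sub]; first by exists 0; rewrite scale0r subr0.
      by apply/nWa/sub; exists 1; rewrite scale1r subrr.
    split=> // c x y [cx Wx] [cy Wy]; exists (c * cx + cy).
    have := Wlin c _ _ Wx Wy.
    by rewrite scalerDl scalerBr scalerA opprD addrACA.
  case: W'1 => c Wc.
  have c0 : c != 0.
    by apply/eqP => c0; move: Wc; rewrite c0 scale0r subr0.
  exists c^-1; have := WZ (- c^-1) _ Wc.
  by rewrite scalerBr !scaleNr opprK scalerA mulVf // scale1r addrC.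
have uniq a c c' : W (a - c *: 1) -> W (a - c' *: 1) -> c = c'.
  move=> Wc Wc'; apply/eqP; rewrite -subr_eq0; apply: contrapT => /negP ncc'.
  apply: W1; have /(WZ (c - c')^-1) := Wlin (-1) _ _ Wc Wc'.
  rewrite scaleN1r opprB addrA subrK -scalerBl scalerA.
  by rewrite mulVf ?scale1r.
have [f fP] := choice ex.
exists (f : A -> K^o) => [c x y|].
  apply: uniq (fP _) _; have := Wlin c _ _ (fP x) (fP y).
  by rewrite scalerDl scalerBr scalerA opprD addrACA.
by apply: uniq (fP _) _; rewrite scale1r subrr.
Qed.

Section TensorAlgebra.
Variables (K : fieldType) (A B : algType K).

Lemma tensor_oner_neq0 : tensor_one A B != 0.
Proof.
have [f flin f1] := unit_functional A.
have [g glin g1] := unit_functional B.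
have fD a a' : f (a + a') = f a + f a'.
  by have := flin 1 a a'; rewrite !scale1r.
have gD a a' : g (a + a') = g a + g a'.
  by have := glin 1 a a'; rewrite !scale1r.
have f0 : f 0 = 0 by apply: (addrI (f 0)); rewrite -fD !addr0.
have g0 : g 0 = 0 by apply: (addrI (g 0)); rewrite -gD !addr0.
have fZ c a : f (c *: a) = c *: f a.
  by have := flin c a 0; rewrite f0 !addr0.
have gZ c a : g (c *: a) = c *: g a.
  by have := glin c a 0; rewrite g0 !addr0.
pose h a b : K^o := (f a : K) * g b.
have hDl a a' b : h (a + a') b = h a b + h a' b by rewrite /h fD mulrDl.
have hDr a b b' : h a (b + b') = h a b + h a b' by rewrite /h gD mulrDr.
have hZl c a b : h (c *: a) b = c *: h a b by rewrite /h fZ /GRing.scale/= mulrA.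
have hZr c a b : h a (c *: b) = c *: h a b.
  by rewrite /h gZ /GRing.scale/= mulrCA.
have h1 := tensor_lift_tens hDl hDr hZl hZr 1 1.
apply/eqP => t10; move: h1; rewrite -/(tensor_one A B) t10 /h f1 g1 mulr1.
have := tensor_lift_is_linear hDl hDr hZl hZr (-1) 0 0.
rewrite scaler0 addr0 scaleN1r addNr => -> /eqP.
by rewrite eq_sym oner_eq0.
Qed.

HB.instance Definition _ := GRing.Zmodule_isNzRing.Build (tensor A B)
  (@tensor_mulA K A B) (@tensor_mul1l K A B) (@tensor_mul1r K A B)
  (@tensor_mulDl K A B) (@tensor_mulDr K A B) tensor_oner_neq0.

Lemma tensor_scaleAl (c : K) (t u : tensor A B) : c *: (t * u) = c *: t * u.
Proof.
elim/tensor_ind: t => x; elim/tensor_ind: u => y.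
rewrite [_ * _]tensor_mul_pi ![c *: tensor_pi _]tensor_scale_pi.
by rewrite [RHS]tensor_mul_pi /tensor_free_mul bextZl.
Qed.

Lemma tensor_scaleAr (c : K) (t u : tensor A B) : c *: (t * u) = t * (c *: u).
Proof.
elim/tensor_ind: t => x; elim/tensor_ind: u => y.
rewrite [_ * _]tensor_mul_pi ![c *: tensor_pi _]tensor_scale_pi.
by rewrite [RHS]tensor_mul_pi /tensor_free_mul bextZr.
Qed.

HB.instance Definition _ :=
  GRing.Lmodule_isLalgebra.Build K (tensor A B) tensor_scaleAl.
HB.instance Definition _ :=
  GRing.Lalgebra_isAlgebra.Build K (tensor A B) tensor_scaleAr.

Lemma tensM (a a' : A) (b b' : B) :
  tens a b * tens a' b' = tens (a * a') (b * b').
Proof. by rewrite [LHS]tensor_mul_pi /tensor_free_mul bextUU. Qed.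

End TensorAlgebra.

(* tensor_grassmann A [:: r_1; ...; r_s] = (A (x) E_{r_1}) (x) ... (x) E_{r_s} *)
Fixpoint tensor_grassmann (K : fieldType) (A : algType K) (rs : seq nat) :
    algType K :=
  if rs is r :: rs' then tensor_grassmann (tensor A (grassmann K 'I_r)) rs'
  else A.

Definition lie_comm (R : pzRingType) (u v : R) : R := u * v - v * u.

(* [u_1, ..., u_m], left-normed *)
Definition long_comm (R : pzRingType) (us : seq R) : R :=
  if us is u :: us' then foldl (@lie_comm R) u us' else 0.

Definition satisfies_long_comm (R : pzRingType) (m : nat) : Prop :=
  forall us : m.-tuple R, long_comm us = 0.

(* Main.v *)
Require Import Defs.
From HB Require Import structures.
From mathcomp Require Import all_boot all_order all_algebra.
From mathcomp Require Import finmap monalg.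

Set Implicit Arguments.
Unset Strict Implicit.
Unset Printing Implicit Defensive.

Import GRing.Theory.
Local Open Scope ring_scope.

(** A left-normed commutator of monomials is, up to a power of 2, either their
    product or 0; it is nonzero iff the product is nonzero and each partial
    product anticommutes with the next factor. Write the monomials as e_S g with
    e_S in E and g in the product of the finite-dimensional factors. As E has
    infinitely many generators, the g_1, ..., g_m occurring in nonzero
    commutators are exactly those with nonzero product for which, among the
    steps j where g_1 ... g_j and g_(j+1) commute, no two are consecutive: at
    such a step e_(S_j) must have odd degree and the degree becomes even. If the
    number m - 1 of steps is even, the pattern is not "commute, anticommute,
    ..., commute", so a further factor g = 1 (a commuting step) can be inserted
    at the beginning, at the end, or between two anticommuting steps. *)

(** * Signs of products of Grassmann basis monomials *)

Section GrassmannBasis.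
Variables (K : fieldType) (d : Order.disp_t) (I : orderType d).
Implicit Types S T : {fset I}.

Definition emon S : grassmann K I := << S >>.

Lemma emonM S T : emon S * emon T =
  (if [disjoint S & T]%fset then (-1) ^+ inversions S T else 0)
    *: emon (S `|` T)%fset.
Proof.
rewrite [LHS]bextUU /grassmann_basis_mul.
by case: ifP => // _; rewrite scale0r.
Qed.

(** For distinct i in S and j in T, the pair is an inversion in exactly one of the two orders. This
    gives the sign in [emonC]. *)
Lemma inversionsC S T : [disjoint S & T]%fset ->
  (inversions S T + inversions T S)%N = (#|` S| * #|` T|)%N.
Proof.
move=> /fdisjointP dST; rewrite /inversions [X in (_ + X)%N]exchange_big /=.
rewrite -big_split /= big_seq.
rewrite (eq_bigr (fun=> #|` T|)) => [|i iS].
  by rewrite -big_seq big_const_seq count_predT iter_addn_0 mulnC.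
rewrite -big_split /= big_seq (eq_bigr (fun=> 1%N)) => [|j jT].
  by rewrite -big_seq sum1_size.
have : i != j by apply: contraTneq jT => <-; exact: dST.
by case: Order.TotalTheory.ltgtP.
Qed.

Lemma emonC S T :
  emon T * emon S = (-1) ^+ (#|` S| * #|` T|) *: (emon S * emon T).
Proof.
rewrite !emonM fdisjoint_sym fsetUC scalerA.
case: ifP => [dST|_]; last by rewrite mulr0.
rewrite -inversionsC // -exprD addnAC addnn exprD.
by rewrite -[X in X * _]signr_odd odd_double mul1r.
Qed.

End GrassmannBasis.

(** * Pure tensors and linear functionals on tensor products *)

Section Tens.
Variables (K : fieldType) (A B : algType K).
Implicit Types (a : A) (b : B).

Lemma tensDl a a' b : tens (a + a') b = tens a b + tens a' b.
Proof. by rewrite /tens -tensor_piD; apply/tensor_piP/tensor_relDl. Qed.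

Lemma tensDr a b b' : tens a (b + b') = tens a b + tens a b'.
Proof. by rewrite /tens -tensor_piD; apply/tensor_piP/tensor_relDr. Qed.

Lemma tensZl c a b : tens (c *: a) b = c *: tens a b.
Proof.
by rewrite /tens [RHS]tensor_scale_pi; apply/tensor_piP/tensor_relZl.
Qed.

Lemma tensZr c a b : tens a (c *: b) = c *: tens a b.
Proof.
by rewrite /tens [RHS]tensor_scale_pi; apply/tensor_piP/tensor_relZr.
Qed.

Lemma tens0l b : tens (0 : A) b = 0.
Proof. by rewrite -(scale0r (0 : A)) tensZl scale0r. Qed.

Lemma tens0r a : tens a (0 : B) = 0.
Proof. by rewrite -(scale0r (0 : B)) tensZr scale0r. Qed.

Lemma tensMC a a' b b' c c' :
  a' * a = c *: (a * a') -> b' * b = c' *: (b * b') ->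
  tens a' b' * tens a b = (c * c') *: (tens a b * tens a' b').
Proof. by move=> Ea Eb; rewrite !tensM Ea Eb tensZl tensZr scalerA. Qed.

Lemma tens_ind (P : tensor A B -> Prop) :
  P 0 -> (forall c x y, P x -> P y -> P (c *: x + y)) ->
  (forall a b, P (tens a b)) -> forall x, P x.
Proof.
move=> P0 PD Pt; elim/tensor_ind; elim/malg_ind => [|c x y Px Py|[a b]].
- suff -> : tensor_pi 0 = 0 :> tensor A B by [].
  by apply: (addrI (tensor_pi 0)); rewrite -tensor_piD !addr0.
- by rewrite tensor_piD -tensor_scale_pi; exact: PD.
- exact: Pt.
Qed.

(** Carries [mon_functional] over to a tensor product, where a product of nonzero monomials is seen
    to be nonzero by such a functional. *)
Lemma tens_functional (f : A -> K^o) (g : B -> K^o) : linear f -> linear g ->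
  exists2 h : tensor A B -> K^o, linear h &
    forall a b, h (tens a b) = (f a : K) * g b.
Proof.
move=> flin glin.
have fD a a' : f (a + a') = f a + f a'.
  by have := flin 1 a a'; rewrite !scale1r.
have gD b b' : g (b + b') = g b + g b'.
  by have := glin 1 b b'; rewrite !scale1r.
have f0 : f 0 = 0 by apply: (addrI (f 0)); rewrite -fD !addr0.
have g0 : g 0 = 0 by apply: (addrI (g 0)); rewrite -gD !addr0.
have fZ c a : f (c *: a) = c *: f a.
  by have := flin c a 0; rewrite f0 !addr0.
have gZ c b : g (c *: b) = c *: g b.
  by have := glin c b 0; rewrite g0 !addr0.
pose h a b : K^o := (f a : K) * g b.
have hDl a a' b : h (a + a') b = h a b + h a' b by rewrite /h fD mulrDl.
have hDr a b b' : h a (b + b') = h a b + h a b' by rewrite /h gD mulrDr.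
have hZl c a b : h (c *: a) b = c *: h a b by rewrite /h fZ /GRing.scale/= mulrA.
have hZr c a b : h a (c *: b) = c *: h a b.
  by rewrite /h gZ /GRing.scale/= mulrCA.
exists (tensor_lift h); first exact: tensor_lift_is_linear.
exact: tensor_lift_tens.
Qed.

End Tens.

(** * Monomial systems for E and its tensor products *)

(* [mon S g] stands for e_S g, with g a monomial in the other tensor factors;
   [mjoin g h] is only meaningful when the product of g and h is nonzero, that
   is, when [mcompat g h]. *)
Record monomial_system (K : fieldType) (A : algType K) := MonomialSystem {
  midx : Type;
  mone : midx;
  mjoin : midx -> midx -> midx;
  mcompat : midx -> midx -> bool;
  manti : midx -> midx -> bool;
  mon : {fset nat} -> midx -> A;
  mjoin1 : forall g, mjoin g mone = g;
  mcompat1 : forall g, mcompat g mone;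
  manti1 : forall g, manti g mone = false;
  monM : forall S g T h,
    exists2 c : K, (c != 0) = [disjoint S & T]%fset && mcompat g h &
      mon S g * mon T h = c *: mon (S `|` T)%fset (mjoin g h);
  monC : forall S g T h, mon T h * mon S g =
    (-1) ^+ (#|` S| * #|` T| + manti g h)%N *: (mon S g * mon T h);
  mon_ind : forall P : A -> Prop,
    P 0 -> (forall c x y, P x -> P y -> P (c *: x + y)) ->
    (forall S g, P (mon S g)) -> forall x, P x;
  mon_functional : forall S g,
    exists2 f : A -> K^o, linear f & f (mon S g) = 1
}.

Section Systems.
Variable K : fieldType.

Lemma emon_functional d (I : orderType d) (S : {fset I}) :
  exists2 f : grassmann K I -> K^o, linear f & f (emon K S) = 1.
Proof.
exists (fun x => (x : {malg K[{fset I}]})@_S); last exact: mcoeffUU.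
by move=> c x y; rewrite mcoeffD mcoeffZ.
Qed.

Lemma emon_coef_neq0 d (I : orderType d) (S T : {fset I}) :
  ((if [disjoint S & T]%fset then (-1) ^+ inversions S T else 0 : K) != 0) =
    [disjoint S & T]%fset.
Proof. by case: ifP; rewrite ?eqxx // signr_eq0. Qed.

Definition grassmann_system : monomial_system (grassmann K nat).
Proof.
apply: (@MonomialSystem K _ unit tt (fun _ _ => tt) (fun _ _ => true)
  (fun _ _ => false) (fun S _ => emon K S)) => //.
- by case.
- move=> S _ T _; exists (if [disjoint S & T]%fset
    then (-1) ^+ inversions S T else 0); last exact: emonM.
  by rewrite emon_coef_neq0 andbT.
- by move=> S _ T _; rewrite addn0 emonC.
- by move=> P P0 PD PU; apply: malg_ind => // S; exact: PU tt.
- by move=> S _; exact: emon_functional.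
Qed.

(** The new factor only enlarges the index g, so S still records the factor E alone. The signs of
    the factors multiply, hence the exclusive or. *)
Definition tensor_system (A : algType K) d (I : orderType d) :
  monomial_system A -> monomial_system (tensor A (grassmann K I)).
Proof.
move=> M; apply: (@MonomialSystem K _ (midx M * {fset I})
  (mone M, fset0)
  (fun g h => (mjoin g.1 h.1, (g.2 `|` h.2)%fset))
  (fun g h => mcompat g.1 h.1 && [disjoint g.2 & h.2]%fset)
  (fun g h => manti g.1 h.1 (+) odd (#|` g.2| * #|` h.2|))
  (fun S g => tens (mon S g.1) (emon K g.2))).
- by case=> g U; rewrite /= mjoin1 fsetU0.
- by case=> g U; rewrite /= mcompat1 fdisjointX0.
- by case=> g U; rewrite manti1 cardfs0 muln0.
- move=> S [g U] T [h V] /=; have [c c0 Ec] := monM S g T h.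
  exists (c * (if [disjoint U & V]%fset then (-1) ^+ inversions U V else 0)).
    by rewrite mulf_eq0 negb_or c0 emon_coef_neq0 andbA.
  by rewrite tensM Ec emonM tensZl tensZr scalerA.
- move=> S [g U] T [h V].
  have -> n : (-1) ^+ (n + (manti g h (+) odd (#|` U| * #|` V|)))%N =
      (-1) ^+ (n + manti g h)%N * (-1) ^+ (#|` U| * #|` V|) :> K.
    by rewrite -exprD -signr_odd -[RHS]signr_odd !oddD !oddb addbA.
  exact: tensMC (monC S g T h) (emonC K U V).
- move=> P P0 PD Pm; apply: tens_ind => // a b.
  elim/(@mon_ind _ _ M): a => [|c x y Px Py|S g]; first by rewrite tens0l.
    by rewrite tensDl tensZl; exact: PD.
  elim/malg_ind: b => [|c x y Px Py|U]; first by rewrite tens0r.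
    by rewrite tensDr tensZr; exact: PD.
  exact: (Pm S (g, U)).
- move=> S [g U] /=; have [f flin f1] := mon_functional S g.
  have [f' flin' f1'] := emon_functional U.
  have [h hlin hE] := tens_functional flin flin'.
  by exists h => //; rewrite hE f1 f1' mulr1.
Qed.

Fixpoint tensor_grassmann_system (A : algType K) (M : monomial_system A)
    (rs : seq nat) : monomial_system (tensor_grassmann A rs) :=
  if rs is r :: rs' then tensor_grassmann_system (tensor_system 'I_r M) rs'
  else M.

End Systems.

(** * Nonzero long commutators of monomials *)

Section LongCommutators.
Variables (K : fieldType) (A : algType K) (M : monomial_system A).
Hypothesis charK2 : 2%N \notin [pchar K].
Implicit Types (S T : {fset nat}) (g h : midx M) (gs : seq (midx M)).

(* [flex] tells whether the E-part of the partial product may have odd degree. *)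
Fixpoint good g (flex : bool) gs : bool :=
  if gs is h :: gs' then
    [&& mcompat g h, flex || manti g h & good (mjoin g h) (manti g h) gs']
  else true.

(** Induction on pairs of steps, with [flex] true before each pair. If the first step anticommutes,
    1 is inserted before it. Otherwise the second must anticommute, which makes [flex] true again
    for the remaining steps. *)
Lemma good_insert g gs : ~~ odd (size gs) -> good g true gs ->
  exists2 gs', size gs' = (size gs).+1 & good g true gs'.
Proof.
have [n] := ubnP (size gs); elim: n g gs => // n IHn g [|h [|h' gs]] //=.
  by exists [:: mone M] => //=; rewrite mcompat1.
move=> len; rewrite negbK => ev /and4P[gh].
have [ghA ghh' _ good'|_ ghh' /= A' good'] := boolP (manti g h).
  exists (mone M :: h :: h' :: gs) => //=.
  by rewrite mcompat1 manti1 mjoin1 gh ghA /= ghh'.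
rewrite A' in good'; have [|gs' sz good''] := IHn _ _ _ ev good'.
  exact: ltnW.
by exists (h :: h' :: gs'); rewrite /= ?sz ?gh ?ghh' ?A' ?orbT.
Qed.

Lemma two_neq0 : 2%:R != 0 :> K.
Proof. by move: charK2; rewrite inE. Qed.

Lemma mon_neq0 S g : mon S g != 0.
Proof.
have [f flin f1] := mon_functional S g.
apply: contra_eq_neq f1 => ->.
have := flin 1 0 0; rewrite !scale1r addr0 => /eqP.
by rewrite eq_sym -subr_eq0 addrK => /eqP ->; rewrite eq_sym oner_eq0.
Qed.

(** The commutator is the product times 1 - (-1)^e, which is 0 for even e and 2, a nonzero scalar,
    for odd e. *)
Lemma lie_comm_mon S g T h :
  exists2 c : K, (c != 0) = [&& [disjoint S & T]%fset, mcompat g h &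
      odd (#|` S| * #|` T|) (+) manti g h] &
    lie_comm (mon S g) (mon T h) = c *: mon (S `|` T)%fset (mjoin g h).
Proof.
have [c c0 Ec] := monM S g T h.
exists ((1 - (-1) ^+ (#|` S| * #|` T| + manti g h)%N) * c).
  rewrite mulf_eq0 negb_or c0 -signr_odd oddD oddb andbC -andbA.
  congr [&& _, _ & _]; case: (_ (+) _); last by rewrite subrr eqxx.
  by rewrite expr1 opprK two_neq0.
by rewrite /lie_comm (monC S g) Ec -scalerA scalerBl scale1r.
Qed.

Lemma lie_commZl c (x u : A) : lie_comm (c *: x) u = c *: lie_comm x u.
Proof. by rewrite /lie_comm scalerBr -scalerAl -scalerAr. Qed.

Lemma foldl_lie_commZ c (x : A) us :
  foldl (@lie_comm A) (c *: x) us = c *: foldl (@lie_comm A) x us.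
Proof. by elim: us x => //= u us IHus x; rewrite lie_commZl IHus. Qed.

Lemma foldl_lie_commD (x y : A) us : foldl (@lie_comm A) (x + y) us =
  foldl (@lie_comm A) x us + foldl (@lie_comm A) y us.
Proof.
elim: us x y => //= u us IHus x y; rewrite -IHus; congr foldl.
by rewrite /lie_comm mulrDl mulrDr opprD addrACA.
Qed.

Lemma foldl_lie_comm0 us : foldl (@lie_comm A) 0 us = 0.
Proof. by have := foldl_lie_commZ 0 0 us; rewrite !scale0r. Qed.

Implicit Type ms : seq ({fset nat} * midx M).
Local Notation mons ms := [seq mon m.1 m.2 | m <- ms].

Lemma cardfsU_disjoint S T :
  [disjoint S & T]%fset -> #|` (S `|` T)%fset| = (#|` S| + #|` T|)%N.
Proof. by move=> /eqP dST; rewrite cardfsU dST cardfs0 subn0. Qed.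

(** If g and h commute, a nonzero commutator needs S and T both odd, so the union is even: the
    implication between parity and [flex] is preserved. *)
Lemma good_of_neq0 S g flex ms : odd #|` S| ==> flex ->
  foldl (@lie_comm A) (mon S g) (mons ms) != 0 -> good g flex (unzip2 ms).
Proof.
elim: ms S g flex => //= -[T h] ms IHms S g flex /= Sflex.
have [c c0 ->] := lie_comm_mon S g T h.
rewrite foldl_lie_commZ scaler_eq0 negb_or c0 => /andP[/and3P[dST -> E]].
move=> /IHms -> //; first by move: Sflex E; rewrite oddM andbT;
  case: (odd _) flex (odd _) (manti _ _) => -[] [] [].
rewrite cardfsU_disjoint // oddD; move: E; rewrite oddM.
by case: (odd #|` S|) (odd #|` T|) (manti _ _) => -[] [].
Qed.

Lemma neq0_of_good S g gs : good g (odd #|` S|) gs ->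
  exists2 ms : seq ({fset nat} * midx M), size ms = size gs &
    foldl (@lie_comm A) (mon S g) (mons ms) != 0.
Proof.
elim: gs S g => [|h gs IHgs] S g /=; first by exists [::]; rewrite ?mon_neq0.
move=> /and3P[gh flex good'].
(* A generator index larger than every element of S. *)
pose n := (\sum_(x <- S) x).+1.
have nS : n \notin S.
  apply/negP => nS; have := leqnn n; rewrite {1}/n ltnNge big_seq_fsetE /=.
  by rewrite (bigD1 [` nS]%fset) //= leq_addr.
(* Makes the degree of the union odd exactly when g and h anticommute, which is the next value of
   [flex]. *)
pose T := if odd #|` S| == manti g h then fset0 else [fset n]%fset.
have dST : [disjoint S & T]%fset.
  by rewrite /T; case: ifP; rewrite ?fdisjointX0 // fdisjointX1.
have oddT : odd #|` T| = odd #|` S| (+) manti g h.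
  rewrite /T -negb_eqb; case: ifP => _; first by rewrite cardfs0.
  by rewrite cardfs1.
have := IHgs (S `|` T)%fset (mjoin g h).
rewrite cardfsU_disjoint // oddD oddT addKb => /(_ good')[ms sz nz].
exists ((T, h) :: ms) => /=; first by rewrite sz.
have [c c0 ->] := lie_comm_mon S g T h.
rewrite foldl_lie_commZ scaler_eq0 negb_or nz c0 dST gh oddM oddT.
by case: (odd _) (manti _ _) flex => -[].
Qed.

Lemma satisfies_long_comm_mon n :
  (forall S g ms, size ms = n -> foldl (@lie_comm A) (mon S g) (mons ms) = 0) ->
  satisfies_long_comm A n.+1.
Proof.
(* The head x is arbitrary, so that entries already made general can be absorbed into it, from left
   to right. *)
pose vanish m x :=
  forall ms, size ms = m -> foldl (@lie_comm A) x (mons ms) = 0.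
move=> vanish_mon us.
suff foldl0 m x : vanish m x -> forall vs, size vs = m ->
    foldl (@lie_comm A) x vs = 0.
  case: (tupleP us) => u vs; rewrite /long_comm /=.
  apply: foldl0 (size_tuple vs).
  elim/(@mon_ind _ _ M): u => [ms _|c x y Px Py ms sz|S g ms].
  - exact: foldl_lie_comm0.
  - by rewrite foldl_lie_commD foldl_lie_commZ Px ?Py ?scaler0 ?addr0.
  - exact: vanish_mon.
elim: m x => [|m IHm] x vx [|v vs] //=; first by move=> _; exact: (vx [::]).
move=> [sz]; apply: IHm sz.
elim/(@mon_ind _ _ M): v => [ms _|c y z Py Pz ms sz|S g ms sz].
- by rewrite /lie_comm mulr0 mul0r subrr foldl_lie_comm0.
- have -> : lie_comm x (c *: y + z) = c *: lie_comm x y + lie_comm x z.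
    rewrite /lie_comm mulrDl mulrDr -scalerAl -scalerAr scalerBr.
    by rewrite opprD addrACA.
  by rewrite foldl_lie_commD foldl_lie_commZ Py ?Pz ?scaler0 ?addr0.
- by have := vx ((S, g) :: ms); rewrite /= sz => ->.
Qed.

Lemma satisfies_long_comm_pred n : ~~ odd n ->
  satisfies_long_comm A n.+2 -> satisfies_long_comm A n.+1.
Proof.
move=> ev id2; apply: satisfies_long_comm_mon => S g ms sz.
apply: contraTeq isT => nz.
have := good_of_neq0 (flex := true) (implybT _) nz.
move=> /good_insert[|gs szgs]; first by rewrite size_map sz.
(* Starting from a single generator of E, of odd degree, makes the initial [flex] true. *)
rewrite -[true]/(odd 1) -(cardfs1 0%N).
move=> /neq0_of_good[ms' sz'] /eqP[].
have szt : size (mon [fset 0%N]%fset g :: mons ms') == n.+2.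
  by rewrite /= size_map sz' szgs size_map sz.
exact: (id2 (Tuple szt)).
Qed.

End LongCommutators.

Theorem proposition2p15 (K : fieldType)
    (charK2 : 2%N \notin [pchar K]) (charK3 : 3%N \notin [pchar K])
    (s : nat) (i : s.-tuple nat) (i_ge2 : forall j : 'I_s, (2 <= tnth i j)%N)
    (k : nat) (k_gt0 : (0 < k)%N) :
  let F : algType K := tensor_grassmann (grassmann K nat) i in
  ~ satisfies_long_comm F (2 * k + 1)%N ->
  ~ satisfies_long_comm F (2 * k + 2)%N.
Proof.
move=> F; rewrite addn1 addn2 => nid id; apply: nid.
(* A commutator of 2k + 1 entries has 2k steps, an even number. *)
apply: satisfies_long_comm_pred id => //; last by rewrite oddM.
exact/tensor_grassmann_system/grassmann_system.
Qed.
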